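(* Let $k$ be a field of characteristic zero. Let $\mathcal{G}$ be a connected graph, possibly with loops, on vertices $x_1,\ldots,x_n$ ($n\geq 2$), and let $A\subset R=k[x_1,\ldots,x_n]$ denote its associated edge-algebra. Let $x_ix_j$ with $i\neq j$ be any proper edge (i.e. not a loop) of $\mathcal{G}$, let $S=k[x_1,\ldots,\widehat{x_j},\ldots,x_n]$, and consider the edge-pinching operation on this edge, given by the $k$-algebra surjection $\pi_{i,j}:R\to S$ with $\pi_{i,j}(x_l)=x_l$ for $l\neq j$ and $\pi_{i,j}(x_j)=x_i$. Then $\mathcal{G}$ is bipartite (in particular, has no loops) if and only if the restriction $\pi_{i,j}|_A:A\to S$ is injective.
   Context: The edge-algebra of a graph with loops on vertices $x_1,\ldots,x_n$ is the $k$-subalgebra of $k[x_1,\ldots,x_n]$ generated by the monomials $x_ax_b$ such that $x_a,x_b$ are joined by an edge (with $x_a^2$ for a loop at $x_a$). A graph with loops is connected if the underlying simple graph obtained by removing all loops is connected. The edge-pinching operation on the edge $x_ix_j$ replaces $\mathcal{G}$ by the graph whose edges and loops correspond to the images under $\pi_{i,j}$ of the monomials defining $\mathcal{G}$. *)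

(* Defs.v *)
From HB Require Import structures.
From mathcomp Require Import all_boot all_order all_algebra.
From mathcomp Require Import mpoly.

Set Implicit Arguments.
Unset Strict Implicit.
Unset Printing Implicit Defensive.

Import GRing.Theory.

Local Open Scope ring_scope.

Inductive subalg_gen (R : nzRingType) (A : algType R) (G : A -> Prop) : A -> Prop :=
  | subalg_gen_in u : G u -> subalg_gen G u
  | subalg_gen_one : subalg_gen G 1
  | subalg_gen_lin (c : R) u v :
      subalg_gen G u -> subalg_gen G v -> subalg_gen G (c *: u + v)
  | subalg_gen_mul u v :
      subalg_gen G u -> subalg_gen G v -> subalg_gen G (u * v).

(* A graph with loops on n vertices is a symmetric [e : rel 'I_n]; there is a
   loop at [a] when [e a a]. *)

Definition simple_part n (e : rel 'I_n) : rel 'I_n :=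
  [rel a b | (a != b) && e a b].

Definition connected_graph n (e : rel 'I_n) : Prop :=
  forall a b, connect (simple_part e) a b.

(* The two parts are [U] and its complement.  Taking [a = b] shows that a
   bipartite graph has no loops. *)
Definition bipartite n (e : rel 'I_n) : Prop :=
  exists U : {set 'I_n}, forall a b, e a b -> (a \in U) != (b \in U).

Definition edge_monomial (k : fieldType) n (e : rel 'I_n) (u : {mpoly k[n]}) : Prop :=
  exists a b, e a b /\ u = 'X_a * 'X_b.

Arguments edge_monomial k {n} e u.

Definition edge_algebra (k : fieldType) n (e : rel 'I_n) : {mpoly k[n]} -> Prop :=
  subalg_gen (edge_monomial k e).

Arguments edge_algebra k {n} e _.

(* The polynomial ring in the variables x_l, l != j, is [{mpoly k[n.-1]}], with
   x_(lift j t) represented by ['X_t].  The value 0 is never used when i != j. *)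
Definition pinch_var (k : fieldType) n (i j l : 'I_n) : {mpoly k[n.-1]} :=
  if unlift j (if l == j then i else l) is Some t then 'X_t else 0.

Definition pinch (k : fieldType) n (i j : 'I_n) : {mpoly k[n]} -> {mpoly k[n.-1]} :=
  comp_mpoly [tuple pinch_var k i j l | l < n].

Arguments pinch k {n} i j _.

Lemma pinchX_lift (k : fieldType) n (i j : 'I_n) (t : 'I_n.-1) :
  pinch k i j 'X_(lift j t) = 'X_t.
Proof.
rewrite /pinch comp_mpolyXU -tnth_nth tnth_mktuple /pinch_var.
by rewrite eq_sym (negbTE (neq_lift j t)) liftK.
Qed.

Lemma pinchX_eq (k : fieldType) n (i j : 'I_n) :
  i != j -> pinch k i j 'X_j = pinch k i j 'X_i.
Proof.
move=> ij; rewrite /pinch !comp_mpolyXU -!tnth_nth !tnth_mktuple /pinch_var.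
by rewrite eqxx (negbTE ij).
Qed.

Lemma pinch_surj (k : fieldType) n (i j : 'I_n) (q : {mpoly k[n.-1]}) :
  exists p : {mpoly k[n]}, pinch k i j p = q.
Proof.
exists (q \mPo [tuple 'X_(lift j t) | t < n.-1]).
rewrite [in RHS](mpolyE q) comp_mpolyEX /pinch linear_sum.
apply: eq_bigr => m _; rewrite linearZ; congr (_ *: _).
rewrite comp_mpolyX rmorph_prod [RHS]mpolyXE_id; apply: eq_bigr => t _.
by rewrite rmorphXn tnth_mktuple; congr (_ ^+ _); exact: pinchX_lift.
Qed.

Definition injective_on (T U : Type) (A : T -> Prop) (f : T -> U) : Prop :=
  forall x y, A x -> A y -> f x = f y -> x = y.

(* Main.v *)
From HB Require Import structures.
Require Import Defs.
From mathcomp Require Import all_boot all_order all_algebra.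
From mathcomp Require Import mpoly.
From mathcomp Require Import zify.

(** When the graph is bipartite, every monomial occurring in an element
of the edge-algebra has the same total degree in the variables of each part
([edge_algebra_balanced]).  Pinching [x_i x_j] forgets only how the sum
[m_i + m_j] of two exponents is split.  As [i] and [j] lie in opposite parts,
the balance condition recovers [m_i - m_j], so that pinching is injective on
balanced monomials ([pinch_mnm_inj]), hence on their linear span.

If the graph is connected and not bipartite, there is a closed walk of odd length
[i = v_0, v_1, ..., v_(2r+1) = i]; this is [no_odd_closed_walk_bipartite], read
contrapositively.  Let [P] be the product of the monomials [x_(v_1) x_(v_2)],
[x_(v_3) x_(v_4)], ..., [x_(v_(2r-1)) x_(v_(2r))], and let [Q] be the product of
the monomials of the remaining edges of the walk.  Both lie in the edge-algebra
and [Q = x_i^2 P] ([walk_quotient]).  Since [x_i x_j] is an edge, [x_i x_j P] lies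
there as well; it differs from [x_i^2 P] and has the same image under the
pinching. *)

Set Implicit Arguments.
Unset Strict Implicit.
Unset Printing Implicit Defensive.

Import GRing.Theory.

Local Open Scope ring_scope.

Lemma mpolyX_neq0 (k : fieldType) n (m : 'X_{1..n}) : 'X_[m] != 0 :> {mpoly k[n]}.
Proof. by rewrite -msupp_eq0 msuppX. Qed.

Lemma mpolyX_inj (k : fieldType) n : injective (fun m : 'X_{1..n} => 'X_[k, m]).
Proof. by move=> m1 m2 /(congr1 (fun p => msupp p)); rewrite !msuppX => -[]. Qed.

(** * Bipartite graphs: pinching is injective on balanced monomials *)

Definition balanced n (U : {set 'I_n}) (m : 'X_{1..n}) : bool :=
  (\sum_(a in U) m a == \sum_(a in ~: U) m a)%N.

Lemma balancedC n (U : {set 'I_n}) m : balanced (~: U) m = balanced U m.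
Proof. by rewrite /balanced setCK eq_sym. Qed.

Lemma balancedD n (U : {set 'I_n}) m1 m2 :
  balanced U m1 -> balanced U m2 -> balanced U (m1 + m2)%MM.
Proof.
have sumD (V : {set 'I_n}) :
  (\sum_(a in V) (m1 + m2)%MM a = \sum_(a in V) m1 a + \sum_(a in V) m2 a)%N.
  by rewrite -big_split; apply: eq_bigr => a _; rewrite mnmDE.
by rewrite /balanced !sumD => /eqP -> /eqP ->.
Qed.

Lemma sum_mnm1_in n (V : {set 'I_n}) c :
  (\sum_(a in V) U_(c)%MM a = (c \in V))%N.
Proof.
case: (boolP (c \in V)) => cV.
  rewrite (bigD1 c) //= mnm1E eqxx big1 // => a /andP[_ ac].
  by rewrite mnm1E eq_sym (negbTE ac).
rewrite big1 // => a aV; rewrite mnm1E; case: eqP => // ca.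
by rewrite ca aV in cV.
Qed.

Lemma balanced_edge n (U : {set 'I_n}) a b :
  (a \in U) != (b \in U) -> balanced U (U_(a) + U_(b))%MM.
Proof.
move=> abU; apply/eqP.
under eq_bigr do rewrite mnmDE; under [RHS]eq_bigr do rewrite mnmDE.
by rewrite !big_split /= !sum_mnm1_in !inE; case: (a \in U) (b \in U) abU => [] [].
Qed.

Lemma edge_algebra_balanced (k : fieldType) n (e : rel 'I_n) (U : {set 'I_n})
    (eU : forall a b, e a b -> (a \in U) != (b \in U)) (p : {mpoly k[n]}) :
  edge_algebra k e p -> {in msupp p, forall m, balanced U m}.
Proof.
elim=> {p} [u [a [b [eab ->]]] m||c u v _ IHu _ IHv m|u v _ IHu _ IHv m].
- by rewrite -mpolyXD msuppX inE => /eqP ->; apply/balanced_edge/eU.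
- move=> m; rewrite msupp1 inE => /eqP ->.
  by apply/eqP; rewrite !big1 // => a _; rewrite mnm0E.
- move=> /msuppD_le; rewrite mem_cat => /orP[/msuppZ_le|]; first exact: IHu.
  exact: IHv.
- by move=> /msuppM_le /allpairsP[[m1 m2] /= [/IHu ? /IHv ? ->]]; apply: balancedD.
Qed.

Definition pinch_mnm n (i j : 'I_n) (m : 'X_{1..n}) : 'X_{1..n.-1} :=
  [multinom (m (lift j t) + (lift j t == i) * m j)%N | t < n.-1].

HB.instance Definition _ (k : fieldType) n (i j : 'I_n) :=
  GRing.RMorphism.copy (pinch k i j)
    (comp_mpoly [tuple pinch_var k i j l | l < n]).

HB.instance Definition _ (k : fieldType) n (i j : 'I_n) :=
  GRing.Linear.copy (pinch k i j)
    (comp_mpoly [tuple pinch_var k i j l | l < n]).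

Lemma pinch_mpolyX (k : fieldType) n (i j : 'I_n) (m : 'X_{1..n}) :
  i != j -> pinch k i j 'X_[m] = 'X_[pinch_mnm i j m].
Proof.
move=> ij; have [s iE] : exists s, i = lift j s.
  by move: ij; rewrite eq_sym => /unlift_some[s]; exists s.
rewrite !mpolyXE_id rmorph_prod (bigD1_ord j) //= rmorphXn /= pinchX_eq // mulrC.
have -> : pinch k i j 'X_i = 'X_s by rewrite {2}iE pinchX_lift.
under eq_bigr do rewrite rmorphXn /= pinchX_lift.
under [RHS]eq_bigr do rewrite mnmE exprD.
rewrite big_split /=; congr (_ * _).
rewrite (bigD1 s) //= -iE eqxx mul1n big1 ?mulr1 // => t ts.
by rewrite iE (inj_eq (@lift_inj _ j)) (negbTE ts) mul0n expr0.
Qed.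

(** The pinched exponents give [m_l] for [l] other than [i] and [j], and the sum
[m_i + m_j]; the balance condition gives [m_i - m_j]. *)
Lemma pinch_mnm_inj n (i j : 'I_n) (U : {set 'I_n}) :
  (i \in U) != (j \in U) ->
  {in balanced U &, injective (pinch_mnm i j)}.
Proof.
wlog iU : U / i \in U => [WL ijU|].
  have [iU|iU] := boolP (i \in U); first exact: WL.
  move=> m1 m2 b1 b2; apply: (WL (~: U)); rewrite ?inE ?[_ \in _]balancedC //.
  by rewrite (inj_eq negb_inj).
rewrite iU eq_sym eqb_id => jU m1 m2 b1 b2 eq_m.
have ij : i != j by apply: contraNneq jU => <-.
have eq_pinch l : l != j ->
  (m1 l + (l == i) * m1 j = m2 l + (l == i) * m2 j)%N.
  rewrite eq_sym => /unlift_some[t -> _].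
  by move/mnmP/(_ t): eq_m; rewrite !mnmE.
have eq_other l : l != i -> l != j -> m1 l = m2 l.
  by move=> li lj; have := eq_pinch l lj; rewrite (negbTE li) !mul0n !addn0.
have eq_sum := eq_pinch i ij; rewrite eqxx !mul1n in eq_sum.
have jCU : j \in ~: U by rewrite inE.
have eqU : (\sum_(a in U | a != i) m1 a = \sum_(a in U | a != i) m2 a)%N.
  apply: eq_bigr => a /andP[aU ai]; apply: eq_other => //.
  by apply: contraNneq jU => <-.
have eqCU : (\sum_(a in ~: U | a != j) m1 a = \sum_(a in ~: U | a != j) m2 a)%N.
  apply: eq_bigr => a /andP[aU aj]; apply: eq_other => //.
  by apply: contraTneq aU => ->; rewrite inE negbK.
have balE m : m \in balanced U -> (m i + \sum_(a in U | a != i) m a =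
    m j + \sum_(a in ~: U | a != j) m a)%N.
  by move=> /eqP; rewrite (bigD1 i) // [in RHS](bigD1 j).
have := balE _ b1; have := balE _ b2; rewrite eqU eqCU => bal2 bal1.
apply/mnmP => l; have [->|li] := eqVneq l i; first by lia.
by have [->|lj] := eqVneq l j; [lia | exact: eq_other].
Qed.

(** The images of distinct monomials of [p] are distinct monomials, so no terms
cancel. *)
Lemma pinch_eq0 (k : fieldType) n (i j : 'I_n) (p : {mpoly k[n]}) :
  i != j -> {in msupp p &, injective (pinch_mnm i j)} ->
  pinch k i j p = 0 -> p = 0.
Proof.
move=> ij inj p0; apply/mpolyP => m; rewrite mcoeff0.
have [mp|/memN_msupp_eq0 //] := boolP (m \in msupp p).
have pinchE : pinch k i j p = \sum_(m <- msupp p) p@_m *: 'X_[pinch_mnm i j m].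
  rewrite [in LHS](mpolyE p) (linear_sum (pinch k i j)).
  by apply: eq_bigr => m' _; rewrite linearZ /= pinch_mpolyX.
move/mpolyP/(_ (pinch_mnm i j m)): p0; rewrite mcoeff0 pinchE raddf_sum /=.
rewrite (bigD1_seq m) ?msupp_uniq //= mcoeffZ mcoeffX eqxx mulr1.
rewrite big1_seq ?addr0 // => m' /andP[m'm m'p].
by rewrite mcoeffZ mcoeffX (inj_in_eq inj) // (negbTE m'm) mulr0.
Qed.

Lemma edge_algebraB (k : fieldType) n (e : rel 'I_n) (p q : {mpoly k[n]}) :
  edge_algebra k e p -> edge_algebra k e q -> edge_algebra k e (p - q).
Proof. by move=> Ap Aq; rewrite addrC -scaleN1r; apply: subalg_gen_lin. Qed.

Lemma bipartite_pinch_inj (k : fieldType) n (e : rel 'I_n) (i j : 'I_n) :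
  e i j -> bipartite e -> injective_on (edge_algebra k e) (pinch k i j).
Proof.
move=> eij [U eU] p q Ap Aq pq; apply/subr0_eq.
have ij : i != j by apply: contraNneq (eU i j eij) => ->.
apply: (pinch_eq0 ij); last by rewrite rmorphB /= pq subrr.
have bal := edge_algebra_balanced eU (edge_algebraB Ap Aq).
by move=> m1 m2 /bal b1 /bal b2; apply: (pinch_mnm_inj (eU i j eij)).
Qed.

(** * Connected graphs that are not bipartite: an odd closed walk *)

(** The bipartite double cover of the graph: a path from [(a, s)] to [(b, t)] is a
walk from [a] to [b] whose length has the parity of [s (+) t]. *)
Definition double_cover n (e : rel 'I_n) : rel ('I_n * bool) :=
  [rel x y | e x.1 y.1 && (x.2 != y.2)].

Section DoubleCover.

Variables (n : nat) (e : rel 'I_n).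
Hypothesis e_sym : ssrbool.symmetric e.

Lemma connect_double_cover_sym : connect_sym (double_cover e).
Proof. by apply: sym_connect_sym => x y; rewrite /double_cover /= e_sym eq_sym. Qed.

Lemma connect_double_cover_flip a b s t :
  connect (double_cover e) (a, s) (b, t) ->
  connect (double_cover e) (a, ~~ s) (b, ~~ t).
Proof.
case/connectP => p; elim: p a s => [|[c u] p IHp] a s /=.
  by move=> _ [-> ->].
move=> /andP[/andP[/= eac su] cp] lp; apply: connect_trans (IHp _ _ cp lp).
by apply: connect1; rewrite /double_cover /= eac (inj_eq negb_inj).
Qed.

Lemma connect_double_cover_lift a b s :
  connect e a b -> exists t, connect (double_cover e) (a, s) (b, t).
Proof.
case/connectP => p; elim: p a s => [|c p IHp] a s /=.
  by move=> _ ->; exists s.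
move=> /andP[eac cp] lp; have [t ct] := IHp _ (~~ s) cp lp; exists t.
by apply: connect_trans ct; apply: connect1; rewrite /double_cover /= eac; case: (s).
Qed.

(** The vertices at even distance from [i] form one part: each vertex is reached
with exactly one parity, and this parity changes along each edge. *)
Lemma no_odd_closed_walk_bipartite i :
  connected_graph e ->
  ~~ connect (double_cover e) (i, false) (i, true) -> bipartite e.
Proof.
move=> e_conn no_odd.
have one_parity b : ~~ (connect (double_cover e) (i, false) (b, false) &&
                        connect (double_cover e) (i, false) (b, true)).
  apply: contra no_odd => /andP[b0 /connect_double_cover_flip /= b1].
  by apply: connect_trans b0 _; rewrite connect_double_cover_sym.
have some_parity b : connect (double_cover e) (i, false) (b, false) ||
                     connect (double_cover e) (i, false) (b, true).
  have : connect e i b.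
    by apply: connect_sub (e_conn i b) => x y /andP[_ exy]; apply: connect1.
  by case/(connect_double_cover_lift false) => [[]] ->; rewrite ?orbT.
exists [set v | connect (double_cover e) (i, false) (v, false)] => a b eab.
have step s : connect (double_cover e) (i, false) (a, s) ->
              connect (double_cover e) (i, false) (b, ~~ s).
  move=> a_s; apply: connect_trans a_s (connect1 _).
  by rewrite /double_cover /= eab; case: (s).
rewrite !inE; move: (step false) (step true) (one_parity b) (some_parity a) => /=.
by do !case: connect => //=; auto.
Qed.

End DoubleCover.

(** Along a walk from [i] to [v], the alternating product of the edges telescopes
to [x_i x_v] or [x_i / x_v] according to the parity of the length; the equation
is stated without denominators. *)
Lemma walk_quotient (k : fieldType) n (e : rel 'I_n) (i v : 'I_n) (s : bool) :
  connect (double_cover e) (i, false) (v, s) ->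
  exists P Q : {mpoly k[n]},
    [/\ edge_algebra k e P, edge_algebra k e Q, P != 0 &
        if s then 'X_i * 'X_v * P = Q else 'X_i * P = 'X_v * Q].
Proof.
case/connectP => p; elim/last_ind: p v s => [|p [w u] IHp] v s.
  move=> _ [-> ->]; exists 1, 1; split=> //; try exact: subalg_gen_one.
  exact: oner_neq0.
rewrite rcons_path last_rcons => /andP[ip /andP[elw tu]] [vE sE].
rewrite {}vE {}sE; case lE: (last _ _) elw tu => [a t] /= eaw tu.
have [P [Q [AP AQ P0 PQ]]] := IHp a t ip (esym lE).
have Aaw : edge_algebra k e ('X_a * 'X_w) by apply: subalg_gen_in; exists a, w.
case: t u tu {ip lE} PQ => [] [] //= _ PQ.
  exists ('X_a * 'X_w * P), Q; split=> //; first exact: subalg_gen_mul.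
    by rewrite !mulf_neq0 ?mpolyX_neq0.
  by rewrite -PQ !mulrA -(mulrA 'X_w) (mulrC 'X_w).
exists P, ('X_a * 'X_w * Q); split=> //; first exact: subalg_gen_mul.
by rewrite mulrAC PQ mulrAC.
Qed.

Lemma pinch_inj_no_odd_closed_walk (k : fieldType) n (e : rel 'I_n) (i j : 'I_n) :
  i != j -> e i j -> injective_on (edge_algebra k e) (pinch k i j) ->
  ~~ connect (double_cover e) (i, false) (i, true).
Proof.
move=> ij eij inj; apply/negP => /(walk_quotient k)[P [Q [AP AQ P0 PQ]]].
have Aij : edge_algebra k e ('X_i * 'X_j) by apply: subalg_gen_in; exists i, j.
have : 'X_i * 'X_j * P = Q.
  apply: inj => //; first exact: subalg_gen_mul.
  by rewrite -PQ !rmorphM /= (pinchX_eq k ij).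
rewrite -PQ => /(mulIf P0)/(mulfI (mpolyX_neq0 _ _))/mpolyX_inj/eqP.
by rewrite eq_mnm1 eq_sym (negbTE ij).
Qed.

Local Close Scope ring_scope.

Theorem proposition5p3 (k : fieldType) (k_char0 : [pchar k]%R =i pred0)
    (n : nat) (n_ge2 : 2 <= n)
    (e : rel 'I_n) (e_sym : ssrbool.symmetric e) (e_conn : connected_graph e)
    (i j : 'I_n) (i_neq_j : i != j) (e_ij : e i j) :
  bipartite e <-> injective_on (edge_algebra k e) (pinch k i j).
Proof.
split; first exact: bipartite_pinch_inj.
move=> /(pinch_inj_no_odd_closed_walk i_neq_j e_ij).
exact: no_odd_closed_walk_bipartite.
Qed.
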